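(* Let $T$ be an in-star with centre $c$ and leaves $\ell_1,\dots,\ell_n$ (arcs $\ell_i\to c$), carrying only green pebbles: $g_0\ge 0$ on $c$ and $g_i\ge0$ on $\ell_i$. Then the game value of this \textsc{blocking pebbles} position is the nimber $*g_0$.
   Context: \textsc{Blocking pebbles} with green pebbles only is an impartial game on a finite directed acyclic graph with a number of (green) pebbles on each vertex. A move by either player: choose a vertex $v$ and either (1) move a positive number of pebbles from $v$ to a single in-neighbour $u$ of $v$ (arc $u\to v$) at no cost, or (2) remove two pebbles from $v$ and place one pebble on an out-neighbour $w$ of $v$ (arc $v\to w$). Normal play (last player to move wins). $*n$ denotes the nimber (Sprague–Grundy value) $n$. *)

(* Defs.v *)
From mathcomp Require Import all_boot zify.
Set Implicit Arguments.
Unset Strict Implicit.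
Unset Printing Implicit Defensive.

(* Conway games [{ l | r }], with options indexed by arbitrary types. *)
Inductive game : Type :=
  Game (L R : Type) of (L -> game) & (R -> game).

(* [game_cmp x y] is the pair [(x <= y, y <= x)]; computing both at once makes
   Conway's definition of the order structurally recursive (see [game_leE]). *)
Fixpoint game_cmp (x : game) : game -> Prop * Prop :=
  fix game_cmp_x (y : game) : Prop * Prop :=
    match x, y with
    | Game xL xR xl xr, Game yL yR yl yr =>
      ((forall i : xL, ~ (game_cmp (xl i) y).2) /\
       (forall j : yR, ~ (game_cmp_x (yr j)).2),
       (forall j : yL, ~ (game_cmp_x (yl j)).1) /\
       (forall i : xR, ~ (game_cmp (xr i) y).1))
    end.

Definition game_le (x y : game) : Prop := (game_cmp x y).1.

Lemma game_cmp_swap x y :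
  ((game_cmp y x).1 <-> (game_cmp x y).2) /\
  ((game_cmp y x).2 <-> (game_cmp x y).1).
Proof.
elim: x y => xL xR xl IHl xr IHr; elim=> yL yR yl IHyl yr IHyr /=.
split; split=> -[H1 H2]; split=> i.
- by move/(IHyl i).2; apply: H1.
- by move/(IHr i (Game yl yr)).2; apply: H2.
- by move/(IHyl i).2; apply: H1.
- by move/(IHr i (Game yl yr)).2; apply: H2.
- by move/(IHl i (Game yl yr)).1; apply: H1.
- by move/(IHyr i).1; apply: H2.
- by move/(IHl i (Game yl yr)).1; apply: H1.
- by move/(IHyr i).1; apply: H2.
Qed.

Lemma game_leE L R l r L' R' l' r' :
  game_le (@Game L R l r) (@Game L' R' l' r') <->
  (forall i, ~ game_le (Game l' r') (l i)) /\
  (forall j, ~ game_le (r' j) (Game l r)).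
Proof.
split=> -[H1 H2]; split=> i; rewrite /game_le.
- by move/(game_cmp_swap (l i) (Game l' r')).1; apply: H1.
- by move/(game_cmp_swap (Game l r) (r' i)).1; apply: H2.
- by move/(game_cmp_swap (l i) (Game l' r')).1; apply: H1.
- by move/(game_cmp_swap (Game l r) (r' i)).1; apply: H2.
Qed.

Definition game_eq (x y : game) : Prop := game_le x y /\ game_le y x.

(* The impartial game played on [A] with moves [move] (from the first argument
   to the second): both players have the same options. *)
Section Impartial.
Variables (A : Type) (move : A -> A -> Prop).

Definition terminating : Prop := well_founded (fun b a => move a b).

Fixpoint game_of_acc (a : A) (acc : Acc (fun b a => move a b) a) : game :=
  let option_of (b : {b | move a b}) := game_of_acc (Acc_inv acc (proj2_sig b)) in
  Game option_of option_of.

Definition impartial_game (wf : terminating) (a : A) : game :=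
  game_of_acc (wf a).

End Impartial.

Lemma measure_terminating A (move : A -> A -> Prop) (m : A -> nat) :
  (forall a b, move a b -> m b < m a) -> terminating move.
Proof.
move=> lt_m a; have [k le_k] := ubnP (m a).
elim: k a le_k => [a lt_a0|k IHk a le_k]; first by exfalso; rewrite ltn0 in lt_a0.
by constructor=> b /lt_m lt_ba; apply: IHk; apply: leq_trans lt_ba _.
Qed.

(* [nimber n] is [*n]: the Nim heap of size [n], whose options are the [*m]
   with [m < n]. *)
Definition nim_move (n m : nat) : Prop := m < n.

Lemma nim_terminating : terminating nim_move.
Proof. exact: (measure_terminating (m := id)). Qed.

Definition nimber (n : nat) : game := impartial_game nim_terminating n.

Record dag := Dag {
  vertex :> finType;
  arc : rel vertex;
  dag_acyclic : forall s : seq vertex, cycle arc s -> s = [::]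
}.

Definition position (D : dag) := {ffun D -> nat}.

(* Take [a] pebbles from [v] and put [b] pebbles on [w]; only used with
   [v != w] (there are no loops) and [a <= p v]. *)
Definition transfer (D : dag) (p : position D) (v : D) (a : nat) (w : D)
    (b : nat) : position D :=
  [ffun x => if x == v then p x - a else if x == w then p x + b else p x].

Inductive pebble_move (D : dag) (p : position D) : position D -> Prop :=
| move_to_in_neighbour v u k of arc u v & 0 < k <= p v :
    pebble_move p (transfer p v k u k)
| move_to_out_neighbour v w of arc v w & 2 <= p v :
    pebble_move p (transfer p v 2 w 1).

Section Termination.
Variable D : dag.
Implicit Types (p : position D) (u v w : D).

Let height v := #|[set u | connect (@arc D) u v]|.
Let weight p := \sum_v p v * (height v + #|D|.+1).

Lemma arc_neq u v : arc u v -> u != v.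
Proof.
move=> uv; apply/eqP=> e; move: uv; rewrite e => vv.
by have := @dag_acyclic D [:: v]; rewrite /= vv => /(_ isT).
Qed.

Lemma arc_height u v : arc u v -> height u < height v.
Proof.
move=> uv; apply/proper_card/properP; split.
  apply/subsetP=> x; rewrite !inE => xu.
  exact: connect_trans xu (connect1 uv).
exists v; rewrite !inE ?connect0 //; apply/negP=> /connectP[s ps eu].
have := @dag_acyclic D (v :: s); rewrite /= rcons_path ps -eu uv.
by move=> /(_ isT).
Qed.

Lemma weight_transfer p v a w b : v != w -> a <= p v ->
  b * (height w + #|D|.+1) < a * (height v + #|D|.+1) ->
  weight (transfer p v a w b) < weight p.
Proof.
move=> vw le_a lt_ba; rewrite /weight (bigD1 v) //= (bigD1 w) 1?eq_sym //=.
rewrite [ltnRHS](bigD1 v) //= [X in _ < _ + X](bigD1 w) 1?eq_sym //=.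
rewrite !ffunE !eqxx eq_sym (negPf vw).
rewrite (eq_bigr (fun x => p x * (height x + #|D|.+1))); last first.
  by move=> x /andP[xv xw]; rewrite ffunE (negPf xv) (negPf xw).
set S := \sum_(i | _) _; move: S lt_ba.
move: (height v + _) (height w + _) => hv hw S lt_ba.
have : p v * hv = (p v - a) * hv + a * hv by rewrite -mulnDl subnK.
by rewrite mulnDl; lia.
Qed.

Lemma pebble_terminating : terminating (@pebble_move D).
Proof.
apply: (measure_terminating (m := weight)) => p _ [v u k uv|v w vw] /=.
  case/andP=> k0 le_k; apply: weight_transfer => //.
    by rewrite eq_sym arc_neq.
  by rewrite ltn_pmul2l // ltn_add2r arc_height.
move=> le2; apply: weight_transfer (arc_neq vw) le2 _.
have : height w <= #|D| by apply: max_card.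
by lia.
Qed.

End Termination.

Definition blocking_pebbles (D : dag) (p : position D) : game :=
  impartial_game (@pebble_terminating D) p.

Definition in_star (T : dag) (c : T) (n : nat) (leaf : 'I_n -> T) : Prop :=
  [/\ injective leaf,
      forall v, v != c <-> exists i, v = leaf i &
      forall u v, arc u v <-> exists i, u = leaf i /\ v = c].

(* Main.v *)
Require Import Defs.
From mathcomp Require Import all_boot zify.

(** The number of pebbles on the centre is a Grundy labelling. A move out of
    the centre can lower it to any smaller value, since there is at least one
    leaf; a move out of a leaf raises it by one. So no move preserves the label
    and every smaller label is reachable, that is, the label is the mex of the
    labels of the options. *)

Section Grundy.
Variables (A : Type) (move : A -> A -> Prop) (g : A -> nat).

Definition grundy_labelling : Prop :=
  (forall a b, move a b -> g b <> g a) /\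
  (forall a m, m < g a -> exists2 b, move a b & g b = m).

Hypothesis grundy_g : grundy_labelling.

(* The accessibility proofs are arbitrary because [Acc_inv] produces new ones
   for the options. Equivalences, rather than implications, are what the
   negated comparisons of the induction step require. *)
Lemma grundy_game_of_acc a (acc_a : Acc (fun b a => move a b) a)
    m (acc_m : Acc (fun j m => nim_move m j) m) :
  (game_le (game_of_acc acc_a) (game_of_acc acc_m) <-> m = g a) /\
  (game_le (game_of_acc acc_m) (game_of_acc acc_a) <-> m = g a).
Proof.
have [g_neq g_lt] := grundy_g.
(* The induction runs on a copy, so the proof inside the game stays general. *)
have wf_a := acc_a; elim: wf_a m acc_m acc_a => {}a _ IHa m acc_m.
have wf_m := acc_m; elim: wf_m acc_m => {}m _ IHm [acc_m] [acc_a].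
(* If [m < g a], some option of [a] has label [m]; if [g a < m], the heap [g a] is an option of
   [m]. *)
have mexP : (forall b, move a b -> m <> g b) ->
    (forall j, j < m -> j <> g a) -> m = g a.
  move=> neq_b neq_j; case: (ltngtP m (g a)) => // [lt_m|lt_g].
    by have [b ab gb] := g_lt _ _ lt_m; case: (neq_b b ab).
  by case: (neq_j _ lt_g).
split; rewrite game_leE; split=> [[H1 H2]|m_eq].
- apply: mexP => [b ab|j jm] e.
    by apply: (H1 (exist _ b ab)); apply/(IHa b ab m (Acc_intro _ acc_m) (acc_a b ab)).2.
  by apply: (H2 (exist _ j jm)); apply/(IHm j jm (acc_m j jm) (Acc_intro _ acc_a)).2.
- split=> -[x mx] /=.
    by move/(IHa x mx m (Acc_intro _ acc_m) (acc_a x mx)).2 => e; apply: (g_neq _ _ mx); rewrite -e.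
  by move/(IHm x mx (acc_m x mx) (Acc_intro _ acc_a)).2 => e; rewrite /nim_move in mx; lia.
- apply: mexP => [b ab|j jm] e.
    by apply: (H2 (exist _ b ab)); apply/(IHa b ab m (Acc_intro _ acc_m) (acc_a b ab)).1.
  by apply: (H1 (exist _ j jm)); apply/(IHm j jm (acc_m j jm) (Acc_intro _ acc_a)).1.
- split=> -[x mx] /=.
    by move/(IHm x mx (acc_m x mx) (Acc_intro _ acc_a)).1 => e; rewrite /nim_move in mx; lia.
  by move/(IHa x mx m (Acc_intro _ acc_m) (acc_a x mx)).1 => e; apply: (g_neq _ _ mx); rewrite -e.
Qed.

Lemma grundy_impartial_game (wf : terminating move) a :
  game_eq (impartial_game wf a) (nimber (g a)).
Proof.
by have [H1 H2] := grundy_game_of_acc _ (wf a) _ (nim_terminating (g a));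
  split; [apply/H1 | apply/H2].
Qed.

End Grundy.

Lemma in_star_grundy_labelling (n : nat) (T : dag) (c : T) (leaf : 'I_n -> T) :
  0 < n -> in_star c leaf ->
  grundy_labelling (position T) (@pebble_move T) (fun p => p c).
Proof.
move=> n_gt0 [_ _ arcP]; split=> [p _ [v u k|v w]|p m lt_m].
- by case/arcP=> i [_ ->] k_le; rewrite ffunE eqxx; lia.
(* As [v] is not the centre, [transfer] adds one at [c]. *)
- move=> vw; have /arcP[_ [_ w_c]] := vw; move: (arc_neq vw).
  by rewrite w_c eq_sym ffunE => /negPf->; rewrite eqxx; lia.
(* The excess over [m], positive since [m < p c], goes to a leaf, which exists by [n_gt0]. *)
- exists (transfer p c (p c - m) (leaf (Ordinal n_gt0)) (p c - m)).
    apply: move_to_in_neighbour; last by lia.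
    by apply/arcP; exists (Ordinal n_gt0).
  by rewrite ffunE eqxx; lia.
Qed.

Theorem theorem6 (n : nat) (hn : 0 < n) (T : dag) (c : T) (leaf : 'I_n -> T)
    (hT : in_star c leaf) (p : position T) :
  game_eq (blocking_pebbles p) (nimber (p c)).
Proof.
exact: (grundy_impartial_game _ _ _ (in_star_grundy_labelling _ _ _ _ hn hT)).
Qed.
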